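(* Let $S$ be a nonempty finite set, $\Sigma$ an algebra of subsets of $S$, $X$ a nonempty convex subset of a vector space, $\mathcal{F}$ the set of all functions $f:S\to X$, and let $\{\succsim_A\}_{A\in\Sigma}$ be a collection of preference relations on $\mathcal{F}$. Then the following are equivalent: (i) The collection $\{\succsim_A\}_{A\in\Sigma}$ satisfies Conditional SEU and Dynamic Conservatism; (ii) The collection $\{\succsim_A\}_{A\in\Sigma}$ admits a conservative subjective expected utility representation. Further, if $(u,\mu,\delta)$ and $(u',\mu',\delta')$ both represent $\{\succsim_A\}_{A\in\Sigma}$ (as conservative subjective expected utility representations), then (i) $u'$ is a positive affine transformation of $u$, (ii) $\mu'=\mu$, and (iii) $\delta'(A)=\delta(A)$ for all $A$ such that $A,A^c\in\Sigma_+$.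
   Context: Elements of $\mathcal{F}$ are called acts. An element $x\in X$ is identified with the constant act returning $x$ in every state. For $f,g\in\mathcal{F}$ and $A\in\Sigma$, $fAg$ is the act equal to $f(s)$ for $s\in A$ and to $g(s)$ for $s\in A^c=S\setminus A$. Mixtures of acts are pointwise. $\succ_A$ and $\sim_A$ are the asymmetric and symmetric parts of $\succsim_A$, and $\succsim:=\succsim_S$ (similarly $\succ,\sim$). An event $A\in\Sigma$ is null if $fAg\sim g$ for all $f,g\in\mathcal{F}$, and non-null otherwise; $\Sigma_+\subseteq\Sigma$ is the collection of non-null events. $\Delta(S)$ is the set of probability measures over $S$, and $\mu(s)=\mu(\{s\})$. For $\mu\in\Delta(S)$ and non-null $A$, the Bayesian update is $\mathcal{B}(\mu,A)(B)=\mu(B\cap A)/\mu(A)$. Conditional SEU: for each $A\in\Sigma$, $\succsim_A$ admits a non-degenerate subjective expected utility representation, i.e. there are a non-constant affine $u_A:X\to\mathbb{R}$ and $\mu_A\in\Delta(S)$ with $f\succsim_A g\iff\sum_{s}u_A(f(s))\mu_A(s)\ge\sum_s u_A(g(s))\mu_A(s)$ for all $f,g\in\mathcal{F}$. Dynamic Conservatism: for any $A\in\Sigma_+$ and all $f,g\in\mathcal{F}$, if (i) $f\succsim g$ and (ii) $fAg\succsim g$, then $f\succsim_A g$; further, if both (i) and (ii) are strict, then $f\succ_A g$. Conservative subjective expected utility representation: a triple $(u,\mu,\delta)$ consisting of a non-constant affine utility function $u:X\to\mathbb{R}$, a prior probability $\mu\in\Delta(S)$ and a function $\delta:\Sigma_+\to[0,1]$,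 such that $\succsim=\succsim_S$ is represented by $(u,\mu)$, i.e. $f\succsim g\iff\sum_s u(f(s))\mu(s)\ge\sum_s u(g(s))\mu(s)$, and for all $A\in\Sigma_+$ and all $f,g\in\mathcal{F}$, $$f\succsim_A g\iff\sum_{s\in S}u(f(s))\mu_A(s)\ge\sum_{s\in S}u(g(s))\mu_A(s),\qquad \mu_A=\delta(A)\mu+(1-\delta(A))\mathcal{B}(\mu,A).$$
   Formalization: As written, (ii) does not imply Conditional SEU, since (ii) leaves preferences at null events (e.g. the empty event) unconstrained; the formal theorem derives Conditional SEU from (ii) only if preferences at null events in Σ have non-degenerate SEU representations. *)

(* Defs.v *)
From mathcomp Require Import all_boot all_order all_algebra.
From mathcomp Require Import classical_sets reals convex.

Set Implicit Arguments.
Unset Strict Implicit.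
Unset Printing Implicit Defensive.

Import Order.TTheory GRing.Theory Num.Theory.
Local Open Scope ring_scope.

Definition is_set_algebra (S : finType) (Sigma : {set {set S}}) : Prop :=
  [/\ finset.set0 \in Sigma,
      (forall A, A \in Sigma -> ~: A \in Sigma) &
      (forall A B, A \in Sigma -> B \in Sigma -> A :|: B \in Sigma)].

Section Acts.
Context (S : finType) (X : Type).

Definition act : Type := S -> X.

(* The act written fAg. *)
Definition splice (f : act) (A : {set S}) (g : act) : act :=
  fun s => if s \in A then f s else g s.

Definition strict_pref (P : act -> act -> Prop) (f g : act) : Prop :=
  P f g /\ ~ P g f.

Definition indiff (P : act -> act -> Prop) (f g : act) : Prop :=
  P f g /\ P g f.

(* A family of preferences is a total function on {set S}; only its values on
   the members of the algebra Sigma are ever constrained. The unconditional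
   preference is its value at the full set. *)
Definition null_event (pref : {set S} -> act -> act -> Prop) (A : {set S}) :
  Prop := forall f g : act, indiff (pref [set: S]) (splice f A g) g.

Definition nonnull_in (Sigma : {set {set S}})
    (pref : {set S} -> act -> act -> Prop) (A : {set S}) : Prop :=
  A \in Sigma /\ ~ null_event pref A.

Definition dynamic_conservatism (Sigma : {set {set S}})
    (pref : {set S} -> act -> act -> Prop) : Prop :=
  forall A, nonnull_in Sigma pref A -> forall f g : act,
    (pref [set: S] f g -> pref [set: S] (splice f A g) g -> pref A f g) /\
    (strict_pref (pref [set: S]) f g ->
     strict_pref (pref [set: S]) (splice f A g) g ->
     strict_pref (pref A) f g).

End Acts.

Section Probabilities.
Context (R : realType) (S : finType).

(* A probability measure on the finite set S is given by its point masses. *)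
Definition is_prob (mu : {ffun S -> R}) : Prop :=
  (forall s, 0 <= mu s) /\ \sum_s mu s = 1.

Definition Pr (mu : {ffun S -> R}) (A : {set S}) : R := \sum_(s in A) mu s.

Definition bayes (mu : {ffun S -> R}) (A : {set S}) : {ffun S -> R} :=
  [ffun s => Pr mu ([set s] :&: A) / Pr mu A].

Definition conservative_update (mu : {ffun S -> R}) (d : R) (A : {set S}) :
    {ffun S -> R} :=
  [ffun s => d * mu s + (1 - d) * bayes mu A s].

End Probabilities.

Section Representations.
Context (R : realType) (V : lmodType R) (X : set V) (S : finType).

(* The points of X form a subtype of V, on which no mixture operation is
   available; z ranges over the points of X equal to the mixture in V (for a
   convex X there is exactly one). *)
Definition affine_on (u : X -> R) : Prop :=
  forall (t : R) (x y z : X), 0 <= t <= 1 ->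
    val z = t *: val x + (1 - t) *: val y ->
    u z = t * u x + (1 - t) * u y.

Definition nonconstant (u : X -> R) : Prop := exists x y : X, u x <> u y.

Definition SEU_represents (u : X -> R) (mu : {ffun S -> R})
    (P : act S X -> act S X -> Prop) : Prop :=
  forall f g : act S X,
    P f g <-> \sum_s u (f s) * mu s >= \sum_s u (g s) * mu s.

Definition nondegenerate_SEU (P : act S X -> act S X -> Prop) : Prop :=
  exists (u : X -> R) (mu : {ffun S -> R}),
    [/\ affine_on u, nonconstant u, is_prob mu & SEU_represents u mu P].

Definition conditional_SEU (Sigma : {set {set S}})
    (pref : {set S} -> act S X -> act S X -> Prop) : Prop :=
  forall A, A \in Sigma -> nondegenerate_SEU (pref A).

(* A conservative representation leaves the preferences conditional on null
   events (the empty event is always one) entirely free, whereas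
   [conditional_SEU] constrains them; this is the missing part. *)
Definition null_conditional_SEU (Sigma : {set {set S}})
    (pref : {set S} -> act S X -> act S X -> Prop) : Prop :=
  forall A, A \in Sigma -> null_event pref A -> nondegenerate_SEU (pref A).

(* delta is a total function; its values outside the non-null members of Sigma
   are irrelevant. *)
Definition conservative_SEU (Sigma : {set {set S}})
    (pref : {set S} -> act S X -> act S X -> Prop)
    (u : X -> R) (mu : {ffun S -> R}) (delta : {set S} -> R) : Prop :=
  [/\ [/\ affine_on u, nonconstant u & is_prob mu],
      (forall A, nonnull_in Sigma pref A -> 0 <= delta A <= 1),
      SEU_represents u mu (pref [set: S]) &
      (forall A, nonnull_in Sigma pref A ->
         SEU_represents u (conservative_update mu (delta A) A) (pref A))].

Definition positive_affine_transform (u' u : X -> R) : Prop :=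
  exists a b : R, 0 < a /\ forall x, u' x = a * u x + b.

End Representations.

(* Main.v *)
(** Constant acts show that the conditional utilities are ordinally equivalent
    to u; affinity makes them positive affine transforms of u. Since the range
    of u contains an interval, every function phi on S is, up to a positive
    factor, a utility difference of two acts, so Dynamic Conservatism becomes:
    E_mu(phi) >= 0 and E_mu(1_A phi) >= 0 imply E_{mu_A}(phi) >= 0. By Farkas'
    lemma mu_A is a nonnegative combination of mu and B(mu, A), whose weights
    add up to 1 because all three are probabilities. For uniqueness, mu_A and mu
    are determined by the preferences, and the weight is recovered as
    mu_A(A^c) / mu(A^c). *)
Require Import Defs.
From mathcomp Require Import all_boot all_order all_algebra.
From mathcomp Require Import classical_sets reals convex.
From mathcomp Require Import boolp interval_inference ring lra.
Import Order.TTheory GRing.Theory Num.Theory.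
Local Open Scope ring_scope.

(** * Expectations on a finite state space and updates of a prior *)

Section Expectations.
Context {R : realType} {S : finType}.
Implicit Types (mu p : {ffun S -> R}) (phi psi : S -> R) (A : {set S}).

Definition expect mu phi : R := \sum_s phi s * mu s.

Definition ind A : S -> R := fun s => (s \in A)%:R.

Lemma eq_expect {mu phi psi} : phi =1 psi -> expect mu phi = expect mu psi.
Proof. by move=> e; apply: eq_bigr => s _; rewrite e. Qed.

Lemma expectB mu phi psi :
  expect mu (fun s => phi s - psi s) = expect mu phi - expect mu psi.
Proof. by rewrite /expect -sumrB; apply: eq_bigr => s _; rewrite mulrBl. Qed.

Lemma expectZ mu a phi : expect mu (fun s => a * phi s) = a * expect mu phi.
Proof. by rewrite /expect mulr_sumr; apply: eq_bigr => s _; rewrite mulrA. Qed.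

Lemma expect_ind mu A : expect mu (ind A) = Pr mu A.
Proof.
rewrite /expect /Pr [RHS]big_mkcond; apply: eq_bigr => s _.
by rewrite /ind; case: ifP; rewrite ?mul1r ?mul0r.
Qed.

Lemma Pr1 mu s : Pr mu [set s] = mu s.
Proof. by rewrite /Pr big_set1. Qed.

Lemma PrT mu : is_prob mu -> Pr mu [set: S] = 1.
Proof. by case=> _ <-; apply: eq_bigl => s; rewrite inE. Qed.

Lemma PrC mu A : is_prob mu -> Pr mu (~: A) = 1 - Pr mu A.
Proof.
move=> [_ <-]; rewrite /Pr [X in _ = X - _](bigID (mem A)) /= addrAC subrr add0r.
by apply: eq_bigl => s; rewrite inE.
Qed.

Lemma Pr_ge0 mu A : is_prob mu -> 0 <= Pr mu A.
Proof. by case=> mu0 _; apply: sumr_ge0 => s _. Qed.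

Lemma Pr_eq0 mu A s : is_prob mu -> Pr mu A = 0 -> s \in A -> mu s = 0.
Proof. by move=> [mu0 _] /psumr_eq0P; apply. Qed.

Lemma bayesE mu A s : bayes mu A s = ind A s * mu s / Pr mu A.
Proof.
rewrite ffunE /ind; case: (boolP (s \in A)) => sA.
  by rewrite (_ : [set s] :&: A = [set s]) ?Pr1 ?mul1r //; apply/finset.setIidPl; rewrite finset.sub1set.
rewrite mul0r (_ : [set s] :&: A = finset.set0) ?/Pr ?big_set0 //.
by apply/eqP; rewrite finset.setI_eq0 finset.disjoints1.
Qed.

Lemma expect_update mu d A phi :
  expect (conservative_update mu d A) phi =
  d * expect mu phi +
  (1 - d) * (expect mu (fun s => ind A s * phi s) / Pr mu A).
Proof.
rewrite /expect !mulr_suml !mulr_sumr -big_split; apply: eq_bigr => s _ /=.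
by rewrite ffunE bayesE; ring.
Qed.

Lemma update_is_prob mu d A :
  is_prob mu -> 0 <= d <= 1 -> 0 < Pr mu A ->
  is_prob (conservative_update mu d A).
Proof.
move=> mu_prob /andP[d0 d1] A0; split=> [s|].
  rewrite ffunE bayesE addr_ge0 ?mulr_ge0 ?subr_ge0 ?invr_ge0 ?ler0n //;
    by [case: mu_prob | exact: ltW].
have := expect_update mu d A (ind [set: S]).
have -> : expect mu (fun s => ind A s * ind [set: S] s) = Pr mu A.
  by rewrite -expect_ind; apply: eq_expect => s; rewrite /ind inE mulr1.
rewrite !expect_ind (PrT mu) // divff ?gt_eqF // => e.
transitivity (Pr (conservative_update mu d A) [set: S]).
  by apply: eq_bigl => s; rewrite inE.
by rewrite e; ring.
Qed.

(** The function 1_{s} - mu(s) has expectation 0 under [mu] and p(s) - mu(s) under [p]. Testing it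
    and its negative gives both inequalities. *)
Lemma prob_unique mu p :
  is_prob mu -> is_prob p ->
  (forall phi, 0 <= expect mu phi -> 0 <= expect p phi) -> p = mu.
Proof.
move=> mu_prob p_prob H; apply/ffunP => s; apply/eqP; rewrite eq_le.
have test q : is_prob q ->
    expect q (fun t => ind [set s] t - mu s * ind [set: S] t) = q s - mu s.
  by move=> q_prob; rewrite expectB expectZ !expect_ind Pr1 PrT // mulr1.
have := H (fun t => - 1 * (ind [set s] t - mu s * ind [set: S] t)).
have := H (fun t => ind [set s] t - mu s * ind [set: S] t).
rewrite !expectZ !test // subrr mulr0 => /(_ (lexx _)) h1 /(_ (lexx _)) h2.
by apply/andP; split; lra.
Qed.

(* Farkas' lemma for the two functionals [expect mu] and [expect mu (ind A * _)].
   The weight is d = p(A^c) / mu(A^c), which is 0 when mu(A^c) = 0. *)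
Lemma update_of_dominated mu p A :
  is_prob mu -> is_prob p -> 0 < Pr mu A ->
  (forall phi, 0 <= expect mu phi ->
     0 <= expect mu (fun s => ind A s * phi s) -> 0 <= expect p phi) ->
  exists2 d, 0 <= d <= 1 & p = conservative_update mu d A.
Proof.
move=> mu_prob p_prob A0 H.
have kernel phi : expect mu phi = 0 ->
    expect mu (fun s => ind A s * phi s) = 0 -> expect p phi = 0.
  move=> e1 e2; have h1 := H phi; have h2 := H (fun s => -1 * phi s).
  rewrite (eq_expect (phi := fun s => ind A s * _)
                     (psi := fun s => -1 * (ind A s * phi s))) in h2;
    last by move=> s; rewrite mulrCA.
  rewrite !expectZ e1 e2 mulr0 lexx in h1 h2.
  by apply/eqP; rewrite eq_le; have := h1 isT isT; have := h2 isT isT; lra.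
(* Both functionals vanish at 1_{s} - (mu(s) / mu(C)) 1_C, so by [kernel] [expect p] does too. If
   mu(C) = 0, the quotient is 0 by convention and the claim reads p(s) = 0. *)
have proportional C s : C \in [:: A; ~: A] -> s \in C ->
    p s = mu s / Pr mu C * Pr p C.
  move=> CA sC; set phi := fun t => ind [set s] t - mu s / Pr mu C * ind C t.
  have E q : expect q phi = q s - mu s / Pr mu C * Pr q C.
    by rewrite expectB expectZ !expect_ind Pr1.
  have E0 : expect mu phi = 0.
    rewrite E; have [C0|C0] := eqVneq (Pr mu C) 0.
      by rewrite (Pr_eq0 _ C s) // C0 mulr0 subr0.
    by rewrite divfK // subrr.
  apply/eqP; rewrite -subr_eq0 -E; apply/eqP; apply: kernel => //.
  move: CA; rewrite !inE => /orP[] /eqP CA.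
    rewrite -[RHS]E0; apply: eq_expect => t; rewrite /phi /ind -CA.
    have [tC|tC] := boolP (t \in C); first by rewrite mul1r.
    rewrite inE mul0r mulr0 subr0; case: eqP => // ts.
    by rewrite ts sC in tC.
  rewrite -[RHS](_ : expect mu (fun t => 0 * ind A t) = 0);
    last by rewrite expectZ mul0r.
  apply: eq_expect => t; rewrite /phi /ind CA !inE mul0r.
  case: (boolP (t \in A)) => tA; last by rewrite mul0r.
  rewrite mulr0 subr0; case: eqP => [ts|_]; last by rewrite mulr0.
  by move: sC; rewrite CA inE -ts tA.
(* Summing [proportional] also covers mu(A^c) = 0: it then yields p(A^c) = 0. *)
have pC : Pr p (~: A) = Pr p (~: A) / Pr mu (~: A) * Pr mu (~: A).
  rewrite {1}/Pr (eq_bigr (fun s => Pr p (~: A) / Pr mu (~: A) * mu s)).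
    by rewrite -mulr_sumr.
  by move=> s sC; rewrite (proportional (~: A) s) ?mem_seq2 ?eqxx ?orbT //; ring.
set d := Pr p (~: A) / Pr mu (~: A) in pC *.
have d0 : 0 <= d by rewrite divr_ge0 ?Pr_ge0.
have pA : Pr p A = 1 - d * (1 - Pr mu A).
  by rewrite -PrC // -pC PrC //; ring.
(* The test function 1_A / mu(A) - 1_{A^c} / mu(A^c) has [mu]-expectation 0 (or 1 if mu(A^c) = 0),
   and 1 after restriction to [A]. Under [p] it gives p(A) / mu(A) - d >= 0, which with [pA]
   simplifies to d <= 1. *)
have d1 : d <= 1.
  have := H (fun s => (Pr mu A)^-1 * ind A s - (Pr mu (~: A))^-1 * ind (~: A) s).
  rewrite (eq_expect (phi := fun s => ind A s * _)
                     (psi := fun s => (Pr mu A)^-1 * ind A s)); last first.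
    by move=> s; rewrite /ind inE; case: (s \in A) => /=; ring.
  rewrite !expectB !expectZ !expect_ind mulVf ?gt_eqF // => /(_ _ ler01).
  rewrite (mulrC _ (Pr p (~: A))) -/d pA subr_ge0 => le_d.
  have : d <= (Pr mu A)^-1 * (1 - d * (1 - Pr mu A)).
    rewrite -subr_ge0; apply: le_d; rewrite mulrC.
    by have [->|?] := eqVneq (Pr mu (~: A)) 0; rewrite ?mul0r ?divff.
  by rewrite ler_pdivlMl //; lra.
exists d; first by rewrite d0.
apply/ffunP => s; rewrite ffunE bayesE /ind.
have [sA|sA] := boolP (s \in A).
  rewrite (proportional A s) ?inE ?eqxx // pA /=; field; exact: lt0r_neq0.
rewrite (proportional (~: A) s) ?mem_seq2 ?inE ?eqxx ?orbT // /d /=; ring.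
Qed.

End Expectations.

(** * Affine utilities on a convex set *)

Section Utilities.
Context {R : realType} {V : lmodType R} {X : set V}.
Hypothesis X_convex : convex_set X.
Implicit Types u v : X -> R.

Lemma mixture_exists (t : R) (x y : X) : 0 <= t <= 1 ->
  exists z : X, val z = t *: val x + (1 - t) *: val y.
Proof.
move=> t01.
have zX := X_convex _ _ (Itv01 (proj1 (andP t01)) (proj2 (andP t01)))
  (valP x) (valP y).
by exists (SigSub zX).
Qed.

Lemma nonconstant_lt u : nonconstant u -> exists x y : X, u x < u y.
Proof.
by case=> x [y /eqP]; rewrite neq_lt => /orP[]; [exists x, y | exists y, x].
Qed.

(** The weak hypothesis makes [v] a function of [u]; the strict one makes the slope positive. A
    point whose utility lies outside the segment from [x0] to [x1] is first contracted into it by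
    mixing. *)
Lemma affine_of_ordinal u v : affine_on u -> nonconstant u -> affine_on v ->
  (forall x y, u y <= u x -> v y <= v x) ->
  (forall x y, u y < u x -> v y < v x) ->
  positive_affine_transform v u.
Proof.
move=> ua unc va le_uv lt_uv; have [x0 [x1 lt01]] := nonconstant_lt _ unc.
have eq_uv x y : u x = u y -> v x = v y.
  by move=> e; apply/eqP; rewrite eq_le !le_uv ?e.
have D0 : 0 < u x1 - u x0 by rewrite subr_gt0.
have vD0 : 0 < v x1 - v x0 by rewrite subr_gt0; exact: lt_uv.
exists ((v x1 - v x0) / (u x1 - u x0)).
exists (v x0 - (v x1 - v x0) / (u x1 - u x0) * u x0).
split=> [|x]; first exact: divr_gt0.
(* For small e, mixing weight e of x into the midpoint of x0 and x1 lands, in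
   utility, between x0 and x1. *)
pose r := (u x - u x0) / (u x1 - u x0).
have ux : u x = u x0 + r * (u x1 - u x0).
  by rewrite /r divfK ?gt_eqF // addrC subrK.
(* Chosen so that e |r| = 1/2 - e, which puts [t] below between e/2 and 1 - 3e/2. *)
pose e : R := (2 * (1 + `|r|))^-1.
have N0 : 0 < 2 * (1 + `|r|) by have := normr_ge0 r; lra.
have e0 : 0 < e by rewrite invr_gt0.
have e1 : e * (2 * (1 + `|r|)) = 1 by rewrite mulVf ?gt_eqF.
have ern : e * `|r| = 2^-1 - e by lra.
have er : - (e * `|r|) <= e * r <= e * `|r|.
  by rewrite -mulrN !ler_pM2l // -ler_norml.
have en : 0 <= e * `|r| by rewrite mulr_ge0 // ltW.
have [m mE] := @mixture_exists 2^-1 x1 x0 ltac:(lra).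
have [z zE] := @mixture_exists e x m ltac:(lra).
pose t := e * r + (1 - e) * 2^-1.
have t01 : 0 <= t <= 1 by rewrite /t; lra.
have [w wE] := @mixture_exists t x1 x0 t01.
have e01 : 0 <= e <= 1 by lra.
have h01 : 0 <= (2^-1 : R) <= 1 by lra.
(* Equal [u] forces equal [v]; expanding both sides by affinity gives an equation linear in [v x],
   in which the coefficient [e] can be cancelled. *)
have zw : v z = v w.
  apply: eq_uv.
  rewrite (ua _ _ _ _ e01 zE) (ua _ _ _ _ h01 mE) (ua _ _ _ _ t01 wE) ux /t.
  by field.
rewrite (va _ _ _ _ e01 zE) (va _ _ _ _ h01 mE) (va _ _ _ _ t01 wE) in zw.
have vx : v x = v x0 + r * (v x1 - v x0).
  apply: (mulfI (lt0r_neq0 e0)).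
  have -> : e * v x = t * v x1 + (1 - t) * v x0 -
     (1 - e) * (2^-1 * v x1 + (1 - 2^-1) * v x0) by rewrite -zw; ring.
  by rewrite /t; field.
by rewrite vx /r; field; exact: lt0r_neq0.
Qed.

(** Mix [x1] and [x0] with weight 1/2 + phi(s) / (2M) in state [s], and compare with the constant
    act at their midpoint. *)
Lemma act_difference (S : finType) u : affine_on u -> nonconstant u ->
  forall phi : S -> R, exists (f g : act S X) (c : R),
    0 < c /\ forall s, u (f s) - u (g s) = c * phi s.
Proof.
move=> ua /nonconstant_lt [x0 [x1 lt01]] phi.
(* The sum bounds every |phi(s)|, keeping the weights in [0, 1]; the summand 1 keeps [M] positive
   when [phi] vanishes. *)
pose M := 1 + \sum_s `|phi s|.
have phiM s : `|phi s| <= M.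
  rewrite /M (bigD1 s) //= addrCA lerDl addr_ge0 //.
  by apply: sumr_ge0.
have M0 : 0 < M by rewrite ltr_pwDl // sumr_ge0.
have t01 s : 0 <= 2^-1 + phi s / (2 * M) <= 1.
  have : `|phi s / (2 * M)| <= 2^-1.
    rewrite normrM normfV (gtr0_norm (_ : 0 < 2 * M)) ?mulr_gt0 //.
    by rewrite ler_pdivrMr ?mulr_gt0 // mulrA mulVf ?mul1r // pnatr_eq0.
  by rewrite ler_norml => /andP[]; lra.
have h01 : 0 <= (2^-1 : R) <= 1 by lra.
have [f fE] := choice (fun s => mixture_exists _ x1 x0 (t01 s)).
have [g gE] := mixture_exists _ x1 x0 h01.
exists f, (fun=> g), ((u x1 - u x0) / (2 * M)); split.
  by rewrite divr_gt0 ?mulr_gt0 // subr_gt0.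
move=> s; rewrite (ua _ _ _ _ (t01 s) (fE s)) (ua _ _ _ _ h01 gE).
by field; exact: lt0r_neq0.
Qed.

End Utilities.

(** * Preferences as signs of expected utility differences *)

Section Representation.
Context {R : realType} {V : lmodType R} {X : set V} {S : finType}.
Implicit Types (u v : X -> R) (mu p : {ffun S -> R}).
Implicit Types (f g : act S X) (P : act S X -> act S X -> Prop).

Definition udiff u f g : S -> R := fun s => u (f s) - u (g s).

Lemma SEU_prefE {u mu P} : SEU_represents u mu P ->
  forall f g, P f g <-> 0 <= expect mu (udiff u f g).
Proof.
move=> rep f g; rewrite (rep f g) -subr_ge0 -sumrB.
rewrite (eq_bigr (fun s => udiff u f g s * mu s)) // => s _.
by rewrite /udiff mulrBl.
Qed.

Lemma expect_udiffC u mu f g :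
  expect mu (udiff u g f) = - expect mu (udiff u f g).
Proof.
rewrite -mulN1r -expectZ; apply: eq_expect => s.
by rewrite /udiff mulN1r opprB.
Qed.

Lemma SEU_strictE {u mu P} : SEU_represents u mu P ->
  forall f g, strict_pref P f g <-> 0 < expect mu (udiff u f g).
Proof.
move=> rep f g; rewrite /strict_pref !(SEU_prefE rep) (expect_udiffC u mu f g).
rewrite oppr_ge0; split=> [[_ /negP]|lt0]; first by rewrite -ltNge.
by split; [exact: ltW | apply/negP; rewrite -ltNge].
Qed.

(** The two acts agree off [A]. This turns premise (ii) of Dynamic Conservatism into a sign
    condition on the functional restricted to [A]. *)
Lemma expect_splice u mu f g A :
  expect mu (udiff u (splice f A g) g) =
  expect mu (fun s => ind A s * udiff u f g s).
Proof.
apply: eq_expect => s; rewrite /udiff /splice /ind.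
by case: ifP => _; rewrite ?mul1r ?mul0r ?subrr.
Qed.

Lemma expect_const u mu (x y : X) A :
  expect mu (fun s => ind A s * udiff u (fun=> x) (fun=> y) s) =
  (u x - u y) * Pr mu A.
Proof.
by rewrite -expect_ind -expectZ; apply: eq_expect => s; rewrite mulrC.
Qed.

Lemma expect_constT u mu (x y : X) : is_prob mu ->
  expect mu (udiff u (fun=> x) (fun=> y)) = u x - u y.
Proof.
move=> mu_prob; rewrite -[RHS]mulr1 -(PrT _ mu_prob) -expect_const.
by apply: eq_expect => s; rewrite /ind inE mul1r.
Qed.

Lemma expect_affine u v a b mu f g : (forall x, v x = a * u x + b) ->
  expect mu (udiff v f g) = a * expect mu (udiff u f g).
Proof.
by move=> vE; rewrite -expectZ; apply: eq_expect => s; rewrite /udiff !vE; ring.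
Qed.

(** If mu(A) = 0, splicing on [A] changes an act only in states of mass 0, so [A] is null. *)
Lemma nonnull_Pr_gt0 Sigma (pref : {set S} -> act S X -> act S X -> Prop) u mu :
  is_prob mu -> SEU_represents u mu (pref [set: S]) ->
  forall A, nonnull_in Sigma pref A -> 0 < Pr mu A.
Proof.
move=> mu_prob rep A [_ nnA]; rewrite lt_neqAle Pr_ge0 // andbT eq_sym.
apply/negP => /eqP A0; apply: nnA => f g.
rewrite /indiff !(SEU_prefE rep) (expect_udiffC _ _ (splice f A g) g).
rewrite expect_splice /expect big1 ?oppr0 ?lexx // => s _.
have [sA|sA] := boolP (s \in A); first by rewrite (Pr_eq0 _ A s) // mulr0.
by rewrite /ind (negPf sA) !mul0r.
Qed.

Lemma conservative_dynamic Sigma (pref : {set S} -> act S X -> act S X -> Prop)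
  u mu delta :
  conservative_SEU Sigma pref u mu delta -> dynamic_conservatism Sigma pref.
Proof.
move=> [[ua unc mu_prob] d01 rep repA] A nnA f g.
have A0 := nonnull_Pr_gt0 _ _ _ _ mu_prob rep _ nnA.
rewrite (SEU_strictE (repA A nnA)) (SEU_prefE (repA A nnA)).
rewrite !(SEU_strictE rep) !(SEU_prefE rep) expect_splice expect_update.
have /andP[d0 d1] := d01 A nnA.
split=> h1 h2; first by rewrite addr_ge0 ?mulr_ge0 ?subr_ge0 ?invr_ge0 // ltW.
have h3 := divr_gt0 h2 A0.
(* At weight 0 strictness comes from the Bayesian term alone; at positive weight the prior term is
   already positive. *)
move: d0; rewrite le_eqVlt => /orP[/eqP <-|d0].
  by rewrite mul0r add0r subr0 mul1r.
by rewrite ltr_pwDl ?mulr_gt0 // mulr_ge0 ?subr_ge0 // ltW.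
Qed.

(** * Uniqueness of representations and existence of the updating weight *)

Hypothesis X_convex : convex_set X.

(** Constant acts compare the utilities. Then [act_difference] realises every [phi] up to a positive
    factor, so [prob_unique] applies. *)
Lemma SEU_unique P u mu v p :
  affine_on u -> nonconstant u -> is_prob mu -> SEU_represents u mu P ->
  affine_on v -> nonconstant v -> is_prob p -> SEU_represents v p P ->
  positive_affine_transform v u /\ p = mu.
Proof.
move=> ua unc mu_prob rep va vnc p_prob repv.
have uvE x y : (u y <= u x) = (v y <= v x).
  rewrite -subr_ge0 -[RHS]subr_ge0 -(expect_constT u mu) // -(expect_constT v p) //.
  by apply/idP/idP; rewrite -(SEU_prefE rep) -(SEU_prefE repv).
have uv : positive_affine_transform v u.
  apply: affine_of_ordinal => // x y; first by rewrite uvE.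
  by rewrite !ltNge uvE.
split=> //; apply: prob_unique => // phi phi0.
have [f [g [c [c0 fg]]]] := act_difference X_convex S _ ua unc phi.
have [a [b [a0 vE]]] := uv.
have scale q : expect q (udiff u f g) = c * expect q phi.
  by rewrite -expectZ; exact: eq_expect.
have /(SEU_prefE rep)/(SEU_prefE repv) : 0 <= expect mu (udiff u f g).
  by rewrite scale mulr_ge0 // ltW.
by rewrite (expect_affine _ _ _ _ _ _ _ vE) scale !pmulr_rge0.
Qed.

Lemma conservative_update_exists Sigma
    (pref : {set S} -> act S X -> act S X -> Prop) u mu A :
  affine_on u -> nonconstant u -> is_prob mu ->
  SEU_represents u mu (pref [set: S]) -> dynamic_conservatism Sigma pref ->
  nonnull_in Sigma pref A -> nondegenerate_SEU (pref A) ->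
  exists2 d, 0 <= d <= 1 &
    SEU_represents u (conservative_update mu d A) (pref A).
Proof.
move=> ua unc mu_prob rep dc nnA [v [p [va vnc p_prob repv]]].
have A0 := nonnull_Pr_gt0 _ _ _ _ mu_prob rep _ nnA.
(* For constant acts the two premises of Dynamic Conservatism are signs of u(x) - u(y) and (u(x) -
   u(y)) mu(A), which agree because mu(A) > 0. *)
have [a [b [a0 vE]]] : positive_affine_transform v u.
  apply: affine_of_ordinal => // x y h;
    have [dcw dcs] := dc A nnA (fun=> x) (fun=> y).
    rewrite -subr_ge0 -(expect_constT v p) // -(SEU_prefE repv).
    apply: dcw; rewrite (SEU_prefE rep) ?expect_splice ?expect_const ?expect_constT //.
      by rewrite subr_ge0.
    by rewrite mulr_ge0 ?subr_ge0 // ltW.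
  rewrite -subr_gt0 -(expect_constT v p) // -(SEU_strictE repv).
  apply: dcs; rewrite (SEU_strictE rep) ?expect_splice ?expect_const ?expect_constT //.
    by rewrite subr_gt0.
  by rewrite mulr_gt0 ?subr_gt0.
have [||| phi phi0 phiA0|d d01 pE] := update_of_dominated mu p A => //.
  have [f [g [c [c0 fg]]]] := act_difference X_convex S _ ua unc phi.
  have scale q : expect q (udiff u f g) = c * expect q phi.
    by rewrite -expectZ; exact: eq_expect.
  have /(SEU_prefE repv) : pref A f g.
    apply: (proj1 (dc A nnA f g)); rewrite (SEU_prefE rep).
      by rewrite scale mulr_ge0 // ltW.
    rewrite expect_splice.
    rewrite (eq_expect (psi := fun s => c * (ind A s * phi s))).
      by rewrite expectZ mulr_ge0 // ltW.
    by move=> s; rewrite /udiff fg mulrCA.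
  by rewrite (expect_affine _ _ _ _ _ _ _ vE) scale !pmulr_rge0.
exists d => // f g; rewrite -pE (SEU_prefE repv).
rewrite (expect_affine _ _ _ _ _ _ _ vE) pmulr_rge0 //.
rewrite -[X in _ <-> is_true X]subr_ge0 -sumrB /expect.
by rewrite (eq_bigr (fun s => u (f s) * p s - u (g s) * p s)) // => s _; rewrite mulrBl.
Qed.

(** The Bayesian part puts no mass on A^c, so an update of weight [c] gives A^c the mass c
    mu(A^c). *)
Lemma update_inj mu A d d' :
  0 < Pr mu (~: A) ->
  conservative_update mu d A = conservative_update mu d' A -> d = d'.
Proof.
move=> A0 e.
have E c : expect (conservative_update mu c A) (ind (~: A)) = c * Pr mu (~: A).
  rewrite expect_update expect_ind (_ : expect mu (fun s => _) = 0).
    by rewrite mul0r mulr0 addr0.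
  by rewrite /expect big1 // => s _; rewrite /ind inE; case: (s \in A);
    rewrite ?mul0r ?mulr0 ?mul0r.
by apply: (mulIf (lt0r_neq0 A0)); rewrite -!E e.
Qed.

End Representation.

Theorem theorem1 (R : realType) (V : lmodType R) (X : set V) (S : finType)
    (Sigma : {set {set S}}) (pref : {set S} -> act S X -> act S X -> Prop)
    (S_nonempty : (0 < #|S|)%N)
    (Sigma_algebra : is_set_algebra Sigma)
    (X_nonempty : exists x : V, X x)
    (X_convex : convex_set X) :
  (* (i) => (ii) *)
  (conditional_SEU Sigma pref /\ dynamic_conservatism Sigma pref ->
   exists u mu delta, conservative_SEU Sigma pref u mu delta) /\
  (* (ii) => (i) *)
  ((exists u mu delta, conservative_SEU Sigma pref u mu delta) ->
   (null_conditional_SEU Sigma pref -> conditional_SEU Sigma pref) /\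
   dynamic_conservatism Sigma pref) /\
  (* uniqueness *)
  (forall u mu delta u' mu' delta',
     conservative_SEU Sigma pref u mu delta ->
     conservative_SEU Sigma pref u' mu' delta' ->
     [/\ positive_affine_transform u' u,
         mu' = mu &
         forall A, nonnull_in Sigma pref A -> nonnull_in Sigma pref (~: A) ->
           delta' A = delta A]).
Proof.
have SigmaT : [set: S] \in Sigma.
  by case: Sigma_algebra => S0 SC _; rewrite -finset.setC0; exact: SC.
split; [|split].
- move=> [cseu dc]; have [u [mu [ua unc mu_prob rep]]] := cseu _ SigmaT.
  have exd A : exists d, nonnull_in Sigma pref A ->
      0 <= d <= 1 /\ SEU_represents u (conservative_update mu d A) (pref A).
    (* The value 0 is a filler where [delta] is unconstrained, so that choice yields a total
       function. *)
    have [nnA|nA] := pselect (nonnull_in Sigma pref A); last by exists 0.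
    have [d] := conservative_update_exists X_convex _ _ _ _ A ua unc mu_prob
      rep dc nnA (cseu A (proj1 nnA)).
    by exists d.
  have [delta deltaP] := choice exd.
  exists u, mu, delta; split=> // A nnA; by case: (deltaP A nnA).
- move=> [u [mu [delta con]]]; split; last exact: conservative_dynamic con.
  move: con => [[ua unc mu_prob] d01 rep repA] null_seu A SA.
  have [nA|nnA] := pselect (null_event pref A); first exact: null_seu.
  have nonnullA : nonnull_in Sigma pref A by [].
  exists u, (conservative_update mu (delta A) A); split=> //; last exact: repA.
  apply: (update_is_prob _ _ _ mu_prob (d01 A nonnullA)).
  exact: (nonnull_Pr_gt0 _ _ _ _ mu_prob rep _ nonnullA).
- move=> u mu delta u' mu' delta' [[ua unc mu_prob] d01 rep repA].
  move=> [[ua' unc' mu_prob'] d01' rep' repA'].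
  have [uu' mumu'] := SEU_unique X_convex _ _ _ _ _ ua unc mu_prob rep
    ua' unc' mu_prob' rep'.
  split=> // A nnA nnCA.
  have A0 := nonnull_Pr_gt0 _ _ _ _ mu_prob rep _ nnA.
  have CA0 := nonnull_Pr_gt0 _ _ _ _ mu_prob rep _ nnCA.
  (* Both updates of the common prior represent [pref A], so they coincide by [SEU_unique];
     non-nullness of A^c supplies mu(A^c) > 0. *)
  apply: (update_inj mu A) => //; rewrite mumu' in repA'.
  have [] // := SEU_unique X_convex _ _ _ _ _ ua unc
    (update_is_prob _ _ _ mu_prob (d01 A nnA) A0) (repA A nnA) ua' unc'
    (update_is_prob _ _ _ mu_prob (d01' A nnA) A0) (repA' A nnA).
Qed.
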